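(* For every morphism $\alpha\colon A\to Y$ in the $\mathsf{Ord}$-enriched category $\mathbb{O}\mathsf{rdAb}$ of preordered abelian groups, the precomma object functor $V_{\alpha}\colon \mathbb{O}\mathsf{rdAb}/Y\to \mathbb{O}\mathsf{rdAb}/A$ between slice categories is conservative (i.e. reflects isomorphisms).
   Context: A preordered abelian group is an abelian group $(X,+,0)$ with a preorder (reflexive transitive relation) $\le$ such that $x\le y$ and $u\le v$ imply $x+u\le y+v$; the preorder is determined by its positive cone, the submonoid $P_X=\{x\in X: 0\le x\}$. $\mathbb{O}\mathsf{rdAb}$ is the category of preordered abelian groups and monotone group homomorphisms, with hom-sets preordered by: for $f,g\colon X\to Y$, $f\preccurlyeq g$ iff $f(x)\le g(x)$ for all $x\in P_X$. Precomma object of an ordered pair $(f\colon X\to Y,\ g\colon Z\to Y)$: an object $f/g$ with morphisms $\pi_1\colon f/g\to X$, $\pi_2\colon f/g\to Z$ such that $f\pi_1\preccurlyeq g\pi_2$ and, for all $a\colon B\to X$, $b\colon B\to Z$ with $fa\preccurlyeq gb$, there is a unique $\lambda=\langle a,b\rangle\colon B\to f/g$ with $\pi_1\lambda=a$, $\pi_2\lambda=b$. In $\mathbb{O}\mathsf{rdAb}$ all precomma objects exist: $f/g$ is the group $X\times Z$ with the product projections and positive cone $P_{f/g}=\{(x,z)\in P_X\times P_Z: f(x)\le g(z)\}$. For $\alpha\colon A\to Y$, the (vertical) precomma object functor $V_\alpha\colon\mathbb{O}\mathsf{rdAb}/Y\to\mathbb{O}\mathsf{rdAb}/A$ sends $f\colon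 X\to Y$ to $\pi_1\colon\alpha/f\to A$, where $(\alpha/f,\pi_1,\pi_2)$ is the precomma object of $(\alpha,f)$, and sends a morphism $\gamma\colon g\to f$ over $Y$ (with $g\colon Z\to Y$ and $f\gamma=g$) to the morphism $\langle\rho_1,\gamma\rho_2\rangle\colon\alpha/g\to\alpha/f$ induced by the universal property, where $\rho_1,\rho_2$ are the projections of $\alpha/g$. *)

(* Defs.v *)
From HB Require Import structures.
From Stdlib Require Import RelationClasses.
From mathcomp Require Import all_boot all_algebra.
From mathcomp Require Import boolp.

Set Implicit Arguments.
Unset Strict Implicit.
Unset Printing Implicit Defensive.

Import GRing.Theory.
Local Open Scope ring_scope.

(* Categories with Leibniz equality of morphisms; [comp g f] is "g after f". *)

Record category := Category {
  obj :> Type;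
  hom : obj -> obj -> Type;
  idm : forall X, hom X X;
  comp : forall X Y Z, hom Y Z -> hom X Y -> hom X Z;
  comp_idl : forall X Y (f : hom X Y), comp (idm Y) f = f;
  comp_idr : forall X Y (f : hom X Y), comp f (idm X) = f;
  comp_assoc : forall W X Y Z (h : hom Y Z) (g : hom X Y) (f : hom W X),
    comp h (comp g f) = comp (comp h g) f
}.
Arguments idm {c} X.
Arguments comp {c X Y Z} g f : rename.

Record functor (C D : category) := Functor {
  fobj :> C -> D;
  fmap : forall X Y, hom X Y -> hom (fobj X) (fobj Y);
  fmap_id : forall X, fmap (idm X) = idm (fobj X);
  fmap_comp : forall X Y Z (g : hom Y Z) (f : hom X Y),
    fmap (comp g f) = comp (fmap g) (fmap f)
}.
Arguments fmap {C D} f {X Y} h : rename.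

Definition is_iso (C : category) (X Y : C) (f : hom X Y) : Prop :=
  exists g : hom Y X, comp g f = idm X /\ comp f g = idm Y.

Definition conservative (C D : category) (F : functor C D) : Prop :=
  forall (X Y : C) (f : hom X Y), is_iso (fmap F f) -> is_iso f.

Section Slice.
Variables (C : category) (Y : C).

Record slice_obj := SliceObj { sdom : C; sarr : hom sdom Y }.

Record slice_hom (g f : slice_obj) := SliceHom {
  sfun :> hom (sdom g) (sdom f);
  sfunP : comp (sarr f) sfun = sarr g
}.

Lemma slice_hom_eq (g f : slice_obj) (u v : slice_hom g f) :
  sfun u = sfun v -> u = v.
Proof.
case: u v => [u pu] [v pv] /= euv; case: _ / euv pv => pv.
by congr SliceHom; exact: Prop_irrelevance.
Qed.

Definition slice_id (f : slice_obj) : slice_hom f f :=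
  SliceHom (comp_idr (sarr f)).

Lemma slice_compP (f g h : slice_obj) (v : slice_hom g h) (u : slice_hom f g) :
  comp (sarr h) (comp v u) = sarr f.
Proof. by rewrite comp_assoc !sfunP. Qed.

Definition slice_comp (f g h : slice_obj) (v : slice_hom g h)
  (u : slice_hom f g) : slice_hom f h := SliceHom (slice_compP v u).

Lemma slice_comp_idl (f g : slice_obj) (u : slice_hom f g) :
  slice_comp (slice_id g) u = u.
Proof. by apply: slice_hom_eq; exact: comp_idl. Qed.

Lemma slice_comp_idr (f g : slice_obj) (u : slice_hom f g) :
  slice_comp u (slice_id f) = u.
Proof. by apply: slice_hom_eq; exact: comp_idr. Qed.

Lemma slice_comp_assoc (e f g h : slice_obj)
    (w : slice_hom g h) (v : slice_hom f g) (u : slice_hom e f) :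
  slice_comp w (slice_comp v u) = slice_comp (slice_comp w v) u.
Proof. by apply: slice_hom_eq; exact: comp_assoc. Qed.

Definition slice : category :=
  Category slice_comp_idl slice_comp_idr slice_comp_assoc.

End Slice.

Record ord_category := OrdCategory {
  ord_cat :> category;
  hle : forall X Y : ord_cat, hom X Y -> hom X Y -> Prop;
  hle_preorder : forall X Y : ord_cat, PreOrder (@hle X Y);
  hle_comp : forall (X Y Z : ord_cat) (g g' : hom Y Z) (f f' : hom X Y),
    hle g g' -> hle f f' -> hle (comp g f) (comp g' f')
}.
Arguments hle {o X Y} f g : rename.

Record precomma (C : ord_category) (X Y Z : C) (f : hom X Y) (g : hom Z Y) :=
  Precomma {
  pc_obj : C;
  pc_fst : hom pc_obj X;
  pc_snd : hom pc_obj Z;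
  pc_le : hle (comp f pc_fst) (comp g pc_snd);
  pc_pair : forall (B : C) (a : hom B X) (b : hom B Z),
    hle (comp f a) (comp g b) -> hom B pc_obj;
  pc_pair_fst : forall (B : C) (a : hom B X) (b : hom B Z)
    (ab : hle (comp f a) (comp g b)), comp pc_fst (pc_pair ab) = a;
  pc_pair_snd : forall (B : C) (a : hom B X) (b : hom B Z)
    (ab : hle (comp f a) (comp g b)), comp pc_snd (pc_pair ab) = b;
  pc_pair_unique : forall (B : C) (a : hom B X) (b : hom B Z)
    (ab : hle (comp f a) (comp g b)) (l : hom B pc_obj),
    comp pc_fst l = a -> comp pc_snd l = b -> l = pc_pair ab
}.

Definition has_precommas (C : ord_category) : Type :=
  forall (X Y Z : C) (f : hom X Y) (g : hom Z Y), precomma f g.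

Section PrecommaFunctor.
Variables (C : ord_category) (pc : has_precommas C) (A Y : C).
Variable alpha : hom A Y.

Definition precomma_fobj (f : slice Y) : slice A :=
  SliceObj (pc_fst (pc alpha (sarr f))).

Lemma precomma_fmap_le (g f : slice Y) (gamma : hom g f) :
  hle (comp alpha (pc_fst (pc alpha (sarr g))))
      (comp (sarr f) (comp (sfun gamma) (pc_snd (pc alpha (sarr g))))).
Proof. by rewrite comp_assoc sfunP; exact: pc_le. Qed.

Definition precomma_fmap (g f : slice Y) (gamma : hom g f) :
    hom (precomma_fobj g) (precomma_fobj f) :=
  @SliceHom C A (precomma_fobj g) (precomma_fobj f)
    (pc_pair (pc alpha (sarr f)) (precomma_fmap_le gamma))
    (pc_pair_fst (pc alpha (sarr f)) (precomma_fmap_le gamma)).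

Lemma precomma_fmap_id (f : slice Y) :
  precomma_fmap (idm f) = idm (precomma_fobj f).
Proof.
apply: slice_hom_eq; apply: esym; apply: pc_pair_unique => /=.
- exact: comp_idr.
- by rewrite comp_idl comp_idr.
Qed.

Lemma precomma_fmap_comp (f g h : slice Y) (v : hom g h) (u : hom f g) :
  precomma_fmap (comp v u) = comp (precomma_fmap v) (precomma_fmap u).
Proof.
apply: slice_hom_eq; apply: esym; apply: pc_pair_unique => /=.
- by rewrite comp_assoc !pc_pair_fst.
- by rewrite comp_assoc pc_pair_snd -comp_assoc pc_pair_snd comp_assoc.
Qed.

Definition precomma_functor : functor (slice Y) (slice A) :=
  Functor precomma_fmap_id precomma_fmap_comp.

End PrecommaFunctor.

Record preord_ab := PreordAb {
  carrier :> zmodType;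
  le : carrier -> carrier -> Prop;
  le_preorder : PreOrder le;
  leD : forall x y u v, le x y -> le u v -> le (x + u) (y + v)
}.
Arguments le {p} x y : rename.

Definition poscone (X : preord_ab) (x : X) : Prop := le 0 x.

Lemma le_subE (X : preord_ab) (x y : X) : le x y <-> poscone (y - x).
Proof.
have [rfl _] := le_preorder X.
split=> [xy|yx]; last by have := leD yx (rfl x); rewrite add0r subrK.
by rewrite /poscone -(subrr x); exact: leD xy (rfl (- x)).
Qed.

Section OfCone.
Variables (G : zmodType) (P : G -> Prop).
Hypotheses (P0 : P 0) (PD : forall x y, P x -> P y -> P (x + y)).

Definition cone_le (x y : G) : Prop := P (y - x).

Lemma cone_le_preorder : PreOrder cone_le.
Proof.
split=> [x|x y z xy yz]; first by rewrite /cone_le subrr.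
by rewrite /cone_le -(subrKA y); exact: PD.
Qed.

Lemma cone_leD x y u v : cone_le x y -> cone_le u v -> cone_le (x + u) (y + v).
Proof. by move=> xy uv; rewrite /cone_le opprD addrACA; exact: PD. Qed.

Definition preord_ab_of_cone : preord_ab :=
  PreordAb cone_le_preorder cone_leD.

Lemma poscone_of_cone (x : preord_ab_of_cone) : poscone x <-> P x.
Proof. by rewrite /poscone /= /cone_le subr0. Qed.

End OfCone.

Record monotone_hom (X Y : preord_ab) := MonotoneHom {
  mfun :> {additive X -> Y};
  mfun_le : forall x y : X, le x y -> le (mfun x) (mfun y)
}.

Lemma monotone_hom_eq (X Y : preord_ab) (f g : monotone_hom X Y) :
  f =1 g -> f = g.
Proof.
case: f g => [f pf] [g pg] /= fg.
have {fg} efg : f = g.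
  case: f g fg {pf pg} => [f [[fa]]] [g [[ga]]] /= /funext efg.
  case: _ / efg ga => ga; by have -> : fa = ga by exact: Prop_irrelevance.
case: _ / efg pg => pg; by have -> : pf = pg by exact: Prop_irrelevance.
Qed.

Lemma monotone_of_cone (X Y : preord_ab) (f : {additive X -> Y}) :
  (forall x : X, poscone x -> poscone (f x)) ->
  forall x y : X, le x y -> le (f x) (f y).
Proof.
by move=> fP x y /le_subE xy; apply/le_subE; rewrite -raddfB; exact: fP.
Qed.

Definition mid (X : preord_ab) : monotone_hom X X :=
  @MonotoneHom X X idfun (fun x y xy => xy).

Definition mcomp (X Y Z : preord_ab) (g : monotone_hom Y Z)
    (f : monotone_hom X Y) : monotone_hom X Z :=
  @MonotoneHom X Z (g \o f) (fun x y xy => mfun_le g (mfun_le f xy)).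

Lemma mcomp_idl (X Y : preord_ab) (f : monotone_hom X Y) : mcomp (mid Y) f = f.
Proof. exact: monotone_hom_eq. Qed.

Lemma mcomp_idr (X Y : preord_ab) (f : monotone_hom X Y) : mcomp f (mid X) = f.
Proof. exact: monotone_hom_eq. Qed.

Lemma mcomp_assoc (W X Y Z : preord_ab) (h : monotone_hom Y Z)
    (g : monotone_hom X Y) (f : monotone_hom W X) :
  mcomp h (mcomp g f) = mcomp (mcomp h g) f.
Proof. exact: monotone_hom_eq. Qed.

Definition OrdAb_category : category :=
  Category mcomp_idl mcomp_idr mcomp_assoc.

Definition mhle (X Y : preord_ab) (f g : monotone_hom X Y) : Prop :=
  forall x : X, poscone x -> le (f x) (g x).

Lemma poscone_mfun (X Y : preord_ab) (f : monotone_hom X Y) (x : X) :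
  poscone x -> poscone (f x).
Proof. by move=> /(mfun_le f); rewrite raddf0. Qed.

Lemma mhle_preorder (X Y : preord_ab) : PreOrder (@mhle X Y).
Proof.
have [rfl trs] := le_preorder Y.
by split=> [f x _|f g h fg gh x x0]; [exact: rfl | exact: trs (fg x x0) (gh x x0)].
Qed.

Lemma mhle_comp (X Y Z : preord_ab) (g g' : monotone_hom Y Z)
    (f f' : monotone_hom X Y) :
  mhle g g' -> mhle f f' -> mhle (mcomp g f) (mcomp g' f').
Proof.
move=> gg' ff' x x0; have [_ trs] := le_preorder Z.
by apply: trs (mfun_le g (ff' x x0)) _; apply: gg'; exact: poscone_mfun.
Qed.

Definition OrdAb : ord_category :=
  @OrdCategory OrdAb_category mhle mhle_preorder mhle_comp.

Section OrdAbPrecomma.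
Variables (X Y Z : preord_ab) (f : monotone_hom X Y) (g : monotone_hom Z Y).

Definition precomma_cone (p : (X * Z)%type) : Prop :=
  [/\ poscone p.1, poscone p.2 & le (f p.1) (g p.2)].

Lemma precomma_cone0 : precomma_cone 0.
Proof.
have [rX _] := le_preorder X; have [rY _] := le_preorder Y.
have [rZ _] := le_preorder Z.
by split; [exact: rX|exact: rZ|rewrite /= !raddf0; exact: rY].
Qed.

Lemma precomma_coneD p q :
  precomma_cone p -> precomma_cone q -> precomma_cone (p + q).
Proof.
move=> [p1 p2 p3] [q1 q2 q3].
split=> /=; rewrite ?raddfD; last exact: leD.
- by rewrite /poscone -[0]addr0; exact: leD.
- by rewrite /poscone -[0]addr0; exact: leD.
Qed.

Definition precomma_ab : preord_ab :=
  preord_ab_of_cone precomma_cone0 precomma_coneD.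

Lemma precomma_fst_cone (p : precomma_ab) : poscone p -> poscone p.1.
Proof. by move=> /poscone_of_cone[]. Qed.

Lemma precomma_snd_cone (p : precomma_ab) : poscone p -> poscone p.2.
Proof. by move=> /poscone_of_cone[]. Qed.

Definition precomma_ab_fst : monotone_hom precomma_ab X :=
  @MonotoneHom precomma_ab X (@fst X Z)
    (@monotone_of_cone precomma_ab X (@fst X Z) precomma_fst_cone).

Definition precomma_ab_snd : monotone_hom precomma_ab Z :=
  @MonotoneHom precomma_ab Z (@snd X Z)
    (@monotone_of_cone precomma_ab Z (@snd X Z) precomma_snd_cone).

Lemma precomma_ab_le : mhle (mcomp f precomma_ab_fst) (mcomp g precomma_ab_snd).
Proof. by move=> p /poscone_of_cone[]. Qed.

Section Pair.
Variables (B : preord_ab) (a : monotone_hom B X) (b : monotone_hom B Z).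
Hypothesis ab : mhle (mcomp f a) (mcomp g b).

Definition pair_fun (x : B) : (X * Z)%type := (a x, b x).

Fact pair_fun_is_zmod_morphism : zmod_morphism pair_fun.
Proof. by move=> x y; rewrite /pair_fun !raddfB. Qed.

HB.instance Definition _ :=
  GRing.isZmodMorphism.Build B (X * Z)%type pair_fun pair_fun_is_zmod_morphism.

Lemma pair_fun_cone (x : B) : poscone x -> @poscone precomma_ab (pair_fun x).
Proof.
by move=> x0; apply/poscone_of_cone; split; [exact: poscone_mfun..|exact: ab].
Qed.

Definition precomma_pair : monotone_hom B precomma_ab :=
  @MonotoneHom B precomma_ab pair_fun
    (@monotone_of_cone B precomma_ab pair_fun pair_fun_cone).

Lemma precomma_pair_fst : mcomp precomma_ab_fst precomma_pair = a.
Proof. exact: monotone_hom_eq. Qed.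

Lemma precomma_pair_snd : mcomp precomma_ab_snd precomma_pair = b.
Proof. exact: monotone_hom_eq. Qed.

Lemma precomma_pair_unique (l : monotone_hom B precomma_ab) :
  mcomp precomma_ab_fst l = a -> mcomp precomma_ab_snd l = b -> l = precomma_pair.
Proof.
move=> la lb; apply: monotone_hom_eq => x.
by rewrite /= /pair_fun -la -lb /=; case: (mfun l x).
Qed.

End Pair.

End OrdAbPrecomma.

Definition OrdAb_precomma : has_precommas OrdAb :=
  fun X Y Z f g => @Precomma OrdAb X Y Z f g (precomma_ab f g)
    (precomma_ab_fst f g) (precomma_ab_snd f g) (@precomma_ab_le X Y Z f g)
    (@precomma_pair X Y Z f g) (@precomma_pair_fst X Y Z f g)
    (@precomma_pair_snd X Y Z f g) (@precomma_pair_unique X Y Z f g).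

(* Main.v *)
From mathcomp Require Import all_boot all_algebra.
Require Import Defs.

Set Implicit Arguments.
Unset Strict Implicit.
Unset Printing Implicit Defensive.

Import GRing.Theory.
Local Open Scope ring_scope.

(** The zero homomorphism lies below every monotone homomorphism, because the
    hom-preorder only tests positive elements. Hence [alpha 0] is below [f] for
    every [f : X -> Y], and the second projection of the precomma object of
    [(alpha, f)] is split by [<0, 1> : X -> alpha/f]. This section is natural
    in [f], as is the projection, so every morphism [gamma] of the slice over
    [Y] is a retract of its image [V gamma]. A retract of an isomorphism is an
    isomorphism, its inverse here being [pi_2 (V gamma)^-1 <0, 1>].

    The retract argument is diagrammatic, so [precomma_functor_conservative]
    states it for any category enriched in preorders with maps into [A] that
    are stable under precomposition and that [alpha] sends to lower bounds of
    the hom-preorders; zero homomorphisms are such maps. *)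

(** An inverse [d] of [u] in the base category is automatically a morphism over
    [Y], since [sarr g d = sarr f u d = sarr f]. *)
Lemma slice_iso (C : category) (Y : C) (g f : slice Y) (u : hom g f) :
  is_iso (sfun u) -> is_iso u.
Proof.
move=> [d [du ud]].
have dP : comp (sarr g) d = sarr f by rewrite -(sfunP u) -comp_assoc ud comp_idr.
by exists (SliceHom dP); split; apply: slice_hom_eq.
Qed.

Section LeastMaps.

Variables (C : ord_category) (pc : has_precommas C) (A Y : C).
Variable alpha : hom A Y.
Variable zero : forall X : C, hom X A.
Hypothesis zero_comp :
  forall (W X : C) (h : hom W X), comp (zero X) h = zero W.
Hypothesis alpha_zero_le :
  forall (X : C) (h : hom X Y), hle (comp alpha (zero X)) h.

Lemma precomma_section_le (f : slice Y) :
  hle (comp alpha (zero (sdom f))) (comp (sarr f) (idm (sdom f))).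
Proof. exact: alpha_zero_le. Qed.

Definition precomma_section (f : slice Y) :
    hom (sdom f) (pc_obj (pc alpha (sarr f))) :=
  pc_pair (pc alpha (sarr f)) (precomma_section_le f).

Lemma precomma_section_snd (f : slice Y) :
  comp (pc_snd (pc alpha (sarr f))) (precomma_section f) = idm (sdom f).
Proof. exact: pc_pair_snd. Qed.

Lemma precomma_fmap_snd (g f : slice Y) (u : hom g f) :
  comp (pc_snd (pc alpha (sarr f))) (sfun (precomma_fmap pc alpha u))
  = comp (sfun u) (pc_snd (pc alpha (sarr g))).
Proof. exact: pc_pair_snd. Qed.

(** Both sides are [<0, u>]; the first components agree because [zero] is
    stable under precomposition. *)
Lemma precomma_section_natural (g f : slice Y) (u : hom g f) :
  comp (sfun (precomma_fmap pc alpha u)) (precomma_section g)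
  = comp (precomma_section f) (sfun u).
Proof.
have le0u := alpha_zero_le (comp (sarr f) (sfun u)).
transitivity (pc_pair (pc alpha (sarr f)) le0u).
- apply: pc_pair_unique; rewrite comp_assoc.
  + by rewrite /= pc_pair_fst pc_pair_fst.
  + by rewrite precomma_fmap_snd -comp_assoc precomma_section_snd comp_idr.
- apply: esym; apply: pc_pair_unique; rewrite comp_assoc.
  + by rewrite pc_pair_fst zero_comp.
  + by rewrite precomma_section_snd comp_idl.
Qed.

Lemma precomma_functor_conservative : conservative (precomma_functor pc alpha).
Proof.
move=> g f u [v [vu uv]]; apply: slice_iso.
have vu1 : comp (sfun v) (sfun (precomma_fmap pc alpha u)) = idm _.
  exact: (congr1 (@sfun _ _ _ _) vu).
have uv1 : comp (sfun (precomma_fmap pc alpha u)) (sfun v) = idm _.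
  exact: (congr1 (@sfun _ _ _ _) uv).
set p := pc_snd (pc alpha (sarr g)).
exists (comp p (comp (sfun v) (precomma_section f))); split.
- rewrite -!comp_assoc -precomma_section_natural.
  by rewrite [comp (sfun v) _]comp_assoc vu1 comp_idl precomma_section_snd.
- rewrite comp_assoc -precomma_fmap_snd -comp_assoc.
  rewrite [comp (sfun (precomma_fmap _ _ _)) _]comp_assoc uv1 comp_idl.
  exact: precomma_section_snd.
Qed.

End LeastMaps.

Section ZeroHom.

Variables X A : preord_ab.

Lemma null_fun_monotone (x y : X) :
  le x y -> le ((\0 : {additive X -> A}) x) ((\0 : {additive X -> A}) y).
Proof. by move=> _; have [rfl _] := le_preorder A; exact: rfl. Qed.

Definition zero_hom : monotone_hom X A := MonotoneHom null_fun_monotone.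

End ZeroHom.

(** On a positive element [x] the claim reads [0 <= h x], which is monotonicity
    of [h]; it would fail for the pointwise order on all of [X]. *)
Lemma comp_zero_hom_le (X A Y : preord_ab) (alpha : monotone_hom A Y)
    (h : monotone_hom X Y) :
  mhle (mcomp alpha (zero_hom X A)) h.
Proof. by move=> x x0; rewrite /= raddf0; exact: poscone_mfun. Qed.

Theorem proposition3p1 (A Y : OrdAb) (alpha : hom A Y) :
  conservative (precomma_functor OrdAb_precomma alpha).
Proof.
apply: (@precomma_functor_conservative OrdAb OrdAb_precomma A Y alpha
  (fun X : OrdAb => zero_hom X A)).
- by move=> W X h; exact: monotone_hom_eq.
- by move=> X h; exact: comp_zero_hom_le.
Qed.
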